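(* Let $m>n$, let $0\le t<\log n$ and let $\rho$ be a $t$-bit restriction for $\mathrm{BinPHP}^m_n$. Then every Resolution refutation of $\mathrm{BinPHP}^m_n\!\upharpoonright_\rho$ has size $2^{\Omega(n/\log n)}$; indeed, asymptotically of size at least $e^{\frac{n}{2^{t+2}u}}$, where $u=\log n-t$.
   Context: $n$ is a power of 2; for a hole $a\in[n]$, $a_1\dots a_{\log n}$ is its binary representation; $\omega^1=\omega$, $\omega^0=\neg\omega$. $\mathrm{BinPHP}^m_n$ has variables $\omega_{i,\ell}$ ($i\in[m]$ pigeons, $\ell\in[\log n]$) and, for all $i\neq i'\in[m]$ and $a\in[n]$, the clause $\bigvee_{\ell}\omega_{i,\ell}^{1-a_\ell}\vee\bigvee_\ell\omega_{i',\ell}^{1-a_\ell}$. A $t$-bit restriction is a partial assignment that assigns values to exactly $t$ of the variables $\omega_{i,1},\dots,\omega_{i,\log n}$ for each pigeon $i$. $F\!\upharpoonright_\rho$ is $F$ simplified under $\rho$. Resolution refutation size is the number of inference steps. *)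

(* Defs.v *)
From mathcomp Require Import all_boot.

Set Implicit Arguments.
Unset Strict Implicit.
Unset Printing Implicit Defensive.

Section Resolution.
Variable V : finType.

                                                             
Definition literal := (V * bool)%type.
Definition clause := {set literal}.
Definition cnf := {set clause}.
Definition restriction := {ffun V -> option bool}.

Definition lit_true (rho : restriction) (l : literal) : bool :=
  rho l.1 == Some l.2.
Definition lit_false (rho : restriction) (l : literal) : bool :=
  rho l.1 == Some (~~ l.2).

                                                                 
Definition restrict (rho : restriction) (F : cnf) : cnf :=
  [set [set l in C | ~~ lit_false rho l]
     | C : clause in F & ~~ [exists l in C, lit_true rho l]].

                                                                        
                                                               
Variant inference (avail : clause -> Prop) : clause -> Prop :=
| Resolve (x : V) (C D : clause) of
    avail ((x, true) |: C) & avail ((x, false) |: D) :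
    inference avail (C :|: D)
| Weaken (C D : clause) of avail C & C \subset D :
    inference avail D.

                                                                              
                                                                             
                      
Inductive derivation (F : cnf) : seq clause -> Prop :=
| DerivNil : derivation F [::]
| DerivRcons (pi : seq clause) (C : clause) of
    derivation F pi & inference (fun D => D \in F \/ D \in pi) C :
    derivation F (rcons pi C).

Definition refutation (F : cnf) (pi : seq clause) : Prop :=
  derivation F pi /\ (set0 \in F \/ set0 \in pi).

End Resolution.

Section BinPHP.
Variables m k : nat.

                                                                            
                                            
Definition php_var := ('I_m * 'I_k)%type.

                                                               
Definition hole_bit (a : 'I_(2 ^ k)) (l : 'I_k) : bool :=
  odd (a %/ 2 ^ (k - l.+1)).

Definition not_in_hole (i : 'I_m) (a : 'I_(2 ^ k)) : clause php_var :=
  [set ((i, l), ~~ hole_bit a l) | l : 'I_k].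

Definition BinPHP : cnf php_var :=
  \bigcup_(i : 'I_m) \bigcup_(j : 'I_m | i != j)
    [set not_in_hole i a :|: not_in_hole j a | a : 'I_(2 ^ k)].

Definition bit_restriction (t : nat) (rho : restriction php_var) : Prop :=
  forall i : 'I_m, #|[set l : 'I_k | rho (i, l) != None]| = t.

End BinPHP.

(* Main.v *)
Require Import Defs.
From mathcomp Require Import all_boot all_order all_algebra.
From mathcomp Require Import reals sequences exp.
From mathcomp Require Import lra zify.
Set Implicit Arguments.
Unset Strict Implicit.
Unset Printing Implicit Defensive.
Import Order.TTheory GRing.Theory Num.Theory.

(** Write [u = k - t] for the number of free bits of each pigeon.  A random
    extension of [rho] that fixes one further uniformly chosen free bit of every
    pigeon to a uniform value satisfies a given free literal with probability
    [1/(2u)], independently over pigeons, so a clause mentioning at least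
    [2^(u-1)] pigeons stays unsatisfied with probability at most
    [(1 - 1/(2u))^(2^(u-1)) <= exp(-n/(2^(t+2) u))].  Each such extension leaves
    an unsatisfied clause of this kind in the refutation: otherwise an adversary
    walks from the empty clause back to an axiom, keeping the mentioned pigeons
    in distinct holes, which is possible because each pigeon still has [2^(u-1)]
    holes available.  Hence the union bound bounds the size from below. *)

(** * Adversary argument: a wide unsatisfied clause survives in every refutation *)

Section Adversary.
Variables m k : nat.
Implicit Types (rho sigma : restriction (php_var m k)) (C D : clause (php_var m k)).
Implicit Types (g : {ffun 'I_m -> {ffun 'I_k -> bool}}) (pi : seq (clause (php_var m k))).

(** Only literals on unset variables count: a pigeon outside this set has all its literals in [C]
    decided by [rho], so it may move among its compatible holes. *)
Definition pigeons rho C : {set 'I_m} :=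
  [set i | [exists l, [exists b, (((i, l), b) \in C) && (rho (i, l) == None)]]].

Lemma pigeonsP rho C i :
  reflect (exists l b, ((i, l), b) \in C /\ rho (i, l) = None) (i \in pigeons rho C).
Proof.
rewrite inE; apply: (iffP existsP) => [[l /existsP[b /andP[Cl /eqP rl]]]|[l [b [Cl rl]]]].
  by exists l, b.
by exists l; apply/existsP; exists b; rewrite Cl rl eqxx.
Qed.

Definition extends sigma rho := forall x b, rho x = Some b -> sigma x = Some b.

Definition completes rho g := forall i l b, rho (i, l) = Some b -> g i l = b.

Definition falsifies g C := forall i l b, ((i, l), b) \in C -> g i l = ~~ b.

(* The adversary's invariant: pigeons mentioned by [C] sit in distinct holes. *)
Definition refuted_injectively rho C := exists g,
  [/\ completes rho g, {in pigeons rho C &, injective g} & falsifies g C].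

Lemma pigeons_extends sigma rho C :
  extends sigma rho -> pigeons sigma C \subset pigeons rho C.
Proof.
move=> ext; apply/subsetP => i /pigeonsP[l [b [Cl sl]]]; apply/pigeonsP.
exists l, b; split=> //; case E: (rho (i, l)) => [c|//].
by rewrite (ext _ _ E) in sl.
Qed.

Lemma mem_restrict_BinPHP rho D : D \in restrict rho (BinPHP m k) ->
  exists i j a, i != j /\
    D = [set l in not_in_hole i a :|: not_in_hole j a | ~~ lit_false rho l].
Proof.
case/imsetP => C; rewrite inE => /andP[/bigcupP[i _ /bigcupP[j ij /imsetP[a _ ->]]] _] ->.
by exists i, j, a.
Qed.

Lemma mem_not_in_hole (i : 'I_m) (a : 'I_(2 ^ k)) (l : 'I_k) :
  ((i, l), ~~ hole_bit a l) \in not_in_hole i a.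
Proof. by apply/imsetP; exists l. Qed.

Definition has_free_bits rho := forall i, exists l, rho (i, l) = None.

(** A literal deleted by [rho] sits on a bit where [rho] agrees with the hole [a], so falsifying the
    remaining ones sends both pigeons to [a]. A bit left free by [sigma] keeps each of them
    mentioned. *)
Lemma axiom_collision rho sigma D :
  extends sigma rho -> has_free_bits sigma -> D \in restrict rho (BinPHP m k) ->
  exists i j, [/\ i != j, i \in pigeons sigma D, j \in pigeons sigma D &
    forall g, completes sigma g -> falsifies g D -> g i = g j].
Proof.
move=> ext free /mem_restrict_BinPHP[i [j [a [ij DE]]]].
have unset p l : sigma (p, l) = None -> rho (p, l) = None.
  by case E: (rho (p, l)) => [c|//]; rewrite (ext _ _ E).
have mentioned p : not_in_hole p a \subset not_in_hole i a :|: not_in_hole j a ->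
    p \in pigeons sigma D.
  move=> /subsetP sub; have [l fl] := free p.
  apply/pigeonsP; exists l, (~~ hole_bit a l); split=> //.
  by rewrite DE inE (sub _ (mem_not_in_hole p a l)) /lit_false /= (unset _ _ fl).
exists i, j; split; rewrite ?mentioned ?subsetUl ?subsetUr // => g comp fals.
have hole p : not_in_hole p a \subset not_in_hole i a :|: not_in_hole j a ->
    g p = [ffun l => hole_bit a l].
  move=> /subsetP sub; apply/ffunP => l; rewrite ffunE.
  have := sub _ (mem_not_in_hole p a l).
  case: (boolP (lit_false rho ((p, l), ~~ hole_bit a l))) => [|nf inC].
    by rewrite /lit_false /= negbK => /eqP E _; apply/comp/ext.
  by rewrite (fals p l (~~ hole_bit a l)) ?negbK // DE inE inC nf.
by rewrite !hole ?subsetUl ?subsetUr.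
Qed.

Lemma axiom_not_refuted_injectively rho sigma D :
  extends sigma rho -> has_free_bits sigma -> D \in restrict rho (BinPHP m k) ->
  ~ refuted_injectively sigma D.
Proof.
move=> ext free DF [g [comp inj fals]].
have [i [j [/eqP ij pi_ pj col]]] := axiom_collision ext free DF.
by apply/ij/inj => //; apply: col.
Qed.

Definition completions sigma i : {set {ffun 'I_k -> bool}} :=
  [set h : {ffun 'I_k -> bool} | [forall l, (sigma (i, l) == None) || (sigma (i, l) == Some (h l))]].

Lemma card_completions sigma i :
  #|completions sigma i| = 2 ^ #|[set l | sigma (i, l) == None]|.
Proof.
pose F l : pred bool := [pred b | (sigma (i, l) == None) || (sigma (i, l) == Some b)].
have -> : #|completions sigma i| = #|family F|.
  by apply: eq_card => h; rewrite inE.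
rewrite card_family foldrE big_map big_enum /=.
rewrite (bigID (fun l => sigma (i, l) == None)) /=.
rewrite [X in _ * X]big1 ?muln1 => [|l nl].
  rewrite (eq_bigr (fun=> 2)) => [|l /eqP fl].
    by rewrite prod_nat_const cardsE.
  by rewrite -card_bool; apply: eq_card => b; rewrite !inE fl.
case E: (sigma (i, l)) nl => [c|//] _.
by rewrite -(card1 c); apply: eq_card => b; rewrite !inE E /= eq_sym.
Qed.

Definition satisfied sigma C := [exists x in C, lit_true sigma x].

Lemma falsifies_not_satisfied sigma g C :
  completes sigma g -> falsifies g C -> ~~ satisfied sigma C.
Proof.
move=> comp fals; apply/negP => /existsP[[[i l] b] /andP[Cl /eqP /= sl]].
by have := fals _ _ _ Cl; rewrite (comp _ _ _ sl); case: (b).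
Qed.

(** Pigeonhole: [i] has [2 ^ u] completions, more than the mentioned pigeons occupy, so a fresh one
    exists. *)
Lemma place_pigeon sigma u C g i :
  #|[set l | sigma (i, l) == None]| = u -> #|pigeons sigma C| < 2 ^ u ->
  completes sigma g -> {in pigeons sigma C &, injective g} -> falsifies g C ->
  exists g', [/\ completes sigma g', {in i |: pigeons sigma C &, injective g'}
               & falsifies g' C].
Proof.
move=> free small comp inj fals.
have [iC|iC] := boolP (i \in pigeons sigma C).
  by exists g; split=> //; rewrite (setUidPr _) // sub1set.
have : ~~ (completions sigma i \subset g @: pigeons sigma C).
  apply/negP => /subset_leq_card; rewrite card_completions free leqNgt.
  by rewrite (leq_ltn_trans (leq_imset_card _ _) small).
case/subsetPn => h; rewrite inE => /forallP hi fresh.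
exists [ffun p => if p == i then h else g p]; split.
- move=> p l b; rewrite ffunE; case: eqP => [->|_] E; last exact: comp.
  by have := hi l; rewrite E => /= /eqP[].
- move=> p q; rewrite !in_setU1 !ffunE.
  case: (eqVneq p i) => [->|_] /=; case: (eqVneq q i) => [->|_] //=.
  + by move=> _ qC E; rewrite E imset_f in fresh.
  + by move=> pC _ E; rewrite -E imset_f in fresh.
  + by move=> pC qC; apply: inj.
(* Since [i] is unmentioned, its literals in [C] lie on variables set by [sigma], where the old and
   the new string agree. *)
- move=> p l b Cl; rewrite ffunE; case: eqP => [pi_|_]; last exact: fals Cl.
  rewrite {p}pi_ in Cl; rewrite -(fals _ _ _ Cl).
  have := hi l; case E: (sigma (i, l)) => [c|] /=.
    by move=> /eqP[<-]; rewrite (comp _ _ _ E).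
  by case/negP: iC; apply/pigeonsP; exists l, b.
Qed.

Lemma pigeonsS sigma C D : C \subset D -> pigeons sigma C \subset pigeons sigma D.
Proof.
move=> /subsetP CD; apply/subsetP => i /pigeonsP[l [b [Cl sl]]].
by apply/pigeonsP; exists l, b; split=> //; apply: CD.
Qed.

Lemma pigeonsU1 sigma x C : pigeons sigma (x |: C) \subset x.1.1 |: pigeons sigma C.
Proof.
apply/subsetP => i /pigeonsP[l [b []]]; rewrite !inE => /orP[/eqP<- _|Cl sl].
  by rewrite eqxx.
by apply/orP; right; apply/existsP; exists l; apply/existsP; exists b; rewrite Cl sl eqxx.
Qed.

Lemma refuted_injectivelyW sigma C D :
  C \subset D -> refuted_injectively sigma D -> refuted_injectively sigma C.
Proof.
move=> CD [g [comp inj fals]]; exists g; split=> //.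
  by move=> p q pC qC; apply: inj; apply: (subsetP (pigeonsS sigma CD)).
by move=> i l b Cl; apply: fals; apply: (subsetP CD).
Qed.

(** Narrowness is asked of the conclusion only. For a resolution on a bit of pigeon [i], this pigeon
    is first placed apart from the mentioned ones; its bit then selects the falsified premise. *)
Lemma refuted_premise sigma u (avail : clause (php_var m k) -> Prop) C :
  (forall i, #|[set l | sigma (i, l) == None]| = u) ->
  #|pigeons sigma C| < 2 ^ u -> inference avail C -> refuted_injectively sigma C ->
  exists2 D, avail D & refuted_injectively sigma D.
Proof.
move=> free small inf; case: inf small => [[i l] A B availA availB|A B availA AB] small;
  last first.
  by move=> /(refuted_injectivelyW AB); exists A.
move=> [g [comp inj fals]].
have [g' [comp' inj' fals']] := place_pigeon (free i) small comp inj fals.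
have premise b (E : clause (php_var m k)) : E \subset A :|: B -> g' i l = ~~ b ->
    refuted_injectively sigma (((i, l), b) |: E).
  move=> sub gi; exists g'; split=> //.
    have subp : pigeons sigma (((i, l), b) |: E) \subset i |: pigeons sigma (A :|: B).
      exact: subset_trans (pigeonsU1 _ _ _) (setUS _ (pigeonsS _ sub)).
    by move=> p q pE qE; apply: inj'; apply: (subsetP subp).
  move=> p l' b'; rewrite !inE => /orP[/eqP[-> -> ->] //|Ep].
  by apply: fals'; apply: (subsetP sub).
case E: (g' i l); [exists ((i, l, false) |: B) | exists ((i, l, true) |: A)] => //;
  by apply: premise; rewrite ?subsetUr ?subsetUl ?E.
Qed.

(** A clause refuted injectively is unsatisfied. If all unsatisfied lines were narrow,
    [refuted_premise] would lead from the empty clause back to an axiom, where two mentioned pigeons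
    collide. *)
Lemma exists_wide_clause rho sigma u pi :
  extends sigma rho -> 0 < u ->
  (forall i, #|[set l | sigma (i, l) == None]| = u) ->
  refutation (restrict rho (BinPHP m k)) pi ->
  exists2 C, C \in pi & ~~ satisfied sigma C && (2 ^ u <= #|pigeons sigma C|).
Proof.
move=> ext u_gt0 free [der empty].
have hfree : has_free_bits sigma.
  move=> i; have : 0 < #|[set l | sigma (i, l) == None]| by rewrite free.
  by case/card_gt0P => l; rewrite inE => /eqP; exists l.
have no_axiom := axiom_not_refuted_injectively ext hfree.
(* The backward walk is recast as an induction along the derivation: no line is refuted injectively,
   whereas [set0] is. *)
suff noC : (forall C, C \in pi -> ~~ satisfied sigma C -> #|pigeons sigma C| < 2 ^ u) ->
    forall C, C \in pi -> ~ refuted_injectively sigma C.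
  have [/hasP[C Cpi CP]|/hasPn none] :=
    boolP (has (fun C => ~~ satisfied sigma C && (2 ^ u <= #|pigeons sigma C|)) pi).
    by exists C.
  have ref0 : refuted_injectively sigma set0.
    (* No pigeon is mentioned by [set0], so any completion serves; the default bit [true] is
       arbitrary. *)
    exists [ffun i => [ffun l => odflt true (sigma (i, l))]]; split.
    - by move=> i l b E; rewrite !ffunE E.
    - by move=> p q /pigeonsP[l [b []]]; rewrite inE.
    - by move=> i l b; rewrite inE.
  case: empty => [/no_axiom //|/noC []//] C Cpi ns.
  by have := none C Cpi; rewrite ns -ltnNge.
elim: der {empty} => [//|{}pi C _ IH inf] small.
have {}IH : forall D, D \in pi -> ~ refuted_injectively sigma D.
  by apply: IH => D Dpi; apply: small; rewrite mem_rcons inE Dpi orbT.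
move=> D; rewrite mem_rcons inE => /orP[/eqP->|/IH //] refC.
have sC : #|pigeons sigma C| < 2 ^ u.
  apply: small; first by rewrite mem_rcons mem_head.
  by have [g [comp _ fals]] := refC; apply: falsifies_not_satisfied comp fals.
have [E [/no_axiom|/IH] nE refE] := refuted_premise free sC inf refC; exact: nE refE.
Qed.

(** Settles the case of one free bit, where the bound to prove is 2. Each axiom keeps literals of
    two distinct pigeons, so a single inference from axioms cannot give the empty clause. *)
Lemma refutation_size_ge2 rho pi : has_free_bits rho ->
  refutation (restrict rho (BinPHP m k)) pi -> 2 <= size pi.
Proof.
move=> free [der empty]; rewrite leqNgt; apply/negP => small.
have two D : D \in restrict rho (BinPHP m k) -> 1 < #|D|.
  move=> DF.
  have [//|i [j [ij /pigeonsP[l [b [Di _]]] /pigeonsP[l' [b' [Dj _]]] _]]] :=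
    @axiom_collision rho rho D _ free DF.
  apply/card_gt1P; exists ((i, l), b), ((j, l'), b'); split=> //.
  by apply: contraNneq ij => -[->].
have not0 : set0 \notin restrict rho (BinPHP m k).
  by apply/negP => /two; rewrite cards0.
case: der empty small => [|pi' C _ inf]; first by case=> // F0; rewrite F0 in not0.
rewrite size_rcons mem_rcons; case: pi' inf => [|//] inf empty _.
have {empty}C0 : C = set0.
  by case: empty => [F0|]; [rewrite F0 in not0 | rewrite !inE orbF => /eqP->].
case: inf C0 => [x A B [AF|//] _ /eqP|A B [AF|//] AB B0].
  rewrite setU_eq0 => /andP[/eqP A0 _].
  by have := two _ AF; rewrite A0 setU0 cards1.
by move: (two _ AF) (subset_leq_card AB); rewrite B0 cards0; case: #|A|.
Qed.

End Adversary.

(** * Random one-bit extensions, treated by counting *)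

Section OneMoreBit.
Variables m k : nat.
Implicit Types (rho : restriction (php_var m k)) (C : clause (php_var m k)).
Implicit Type f : {ffun 'I_m -> 'I_k * bool}.

(** The [family] of these predicates is the sample space of the extensions; cardinalities replace
    the uniform measure. *)
Definition free_choices rho (i : 'I_m) : pred ('I_k * bool) :=
  [pred p | rho (i, p.1) == None].

Definition set_bits rho f : restriction (php_var m k) :=
  [ffun x => if (f x.1).1 == x.2 then Some (f x.1).2 else rho x].

Lemma set_bits_extends rho f : f \in family (free_choices rho) ->
  extends (set_bits rho f) rho.
Proof.
move=> /familyP ff [i l] b E; rewrite ffunE /=; case: eqP => // fl.
by have := ff i; rewrite inE fl E.
Qed.

Lemma card_free_choices rho u i : #|[set l | rho (i, l) == None]| = u ->
  #|free_choices rho i| = u.*2.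
Proof.
move=> <-; rewrite -muln2 -card_bool -cardsT -cardsX.
by apply: eq_card => -[l b]; rewrite !inE andbT.
Qed.

Lemma card_free_set_bits rho f u i : f \in family (free_choices rho) ->
  #|[set l | rho (i, l) == None]| = u ->
  #|[set l | set_bits rho f (i, l) == None]| = u.-1.
Proof.
move=> /familyP /(_ i); rewrite inE => fi <-.
rewrite (cardsD1 (f i).1 [set l | rho (i, l) == None]) inE fi /=.
by apply: eq_card => l; rewrite !inE ffunE /=; case: (eqVneq l (f i).1).
Qed.

(** The probability bound [(1 - 1/(2u)) ^ W] with denominators cleared: each mentioned pigeon has a
    choice that satisfies [C], and the choices are independent. *)
Lemma card_unsatisfied_set_bits rho u C W :
  (forall i, #|[set l | rho (i, l) == None]| = u) ->
  W <= #|pigeons rho C| ->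
  #|[set f in family (free_choices rho) | ~~ satisfied (set_bits rho f) C]|
     * u.*2 ^ W <= u.*2 ^ m * u.*2.-1 ^ W.
Proof.
move=> free wide.
pose G (i : 'I_m) : pred ('I_k * bool) :=
  [pred p | (rho (i, p.1) == None) && ((i, p.1, p.2) \notin C)].
have sub : #|[set f in family (free_choices rho) | ~~ satisfied (set_bits rho f) C]|
    <= #|family G|.
  apply/subset_leq_card/subsetP => f; rewrite inE => /andP[/familyP ff ns].
  apply/familyP => i; have := ff i; rewrite !inE => fi; rewrite fi /=.
  apply: contra ns => fC; apply/existsP; exists (i, (f i).1, (f i).2).
  by rewrite fC /lit_true /= ffunE /= eqxx.
have cardG : #|family G| <= u.*2.-1 ^ #|pigeons rho C| * u.*2 ^ (m - #|pigeons rho C|).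
  rewrite card_family foldrE big_map big_enum /=.
  rewrite (bigID (mem (pigeons rho C))) /=.
  have -> : m - #|pigeons rho C| = #|[predC pigeons rho C]|.
    have cP : #|pigeons rho C| + #|[predC pigeons rho C]| = m by rewrite cardC card_ord.
    by rewrite -[X in X - _]cP addKn.
  rewrite -!prod_nat_const; apply: leq_mul; apply: leq_prod => i iC.
    (* Giving bit [l] the value [b] would satisfy [C], so this pigeon loses at least one of its
       [u.*2] choices. *)
    have /pigeonsP[l [b [Cl rl]]] := iC.
    rewrite -(card_free_choices (free i)) (cardD1 (l, b) (free_choices rho i)).
    have -> : (l, b) \in free_choices rho i by rewrite inE /= rl.
    rewrite add1n /=.
    apply/subset_leq_card/subsetP => p; rewrite !inE => /andP[-> np]; rewrite andbT.
    by apply: contraNneq np => ->.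
  rewrite -(card_free_choices (free i)).
  by apply/subset_leq_card/subsetP => p; rewrite !inE => /andP[].
apply: leq_trans (leq_mul (leq_trans sub cardG) (leqnn _)) _.
have pm : #|pigeons rho C| <= m by rewrite -[X in _ <= X]card_ord max_card.
move: #|pigeons rho C| pm wide => p pm wide.
(* For the mentioned pigeons beyond [W], the factor [u.*2.-1] is relaxed to [u.*2]. *)
have le : u.*2.-1 ^ (p - W) <= u.*2 ^ (p - W).
  by case: (p - W) => // a; rewrite leq_exp2r // leq_pred.
have -> : u.*2 ^ m = u.*2 ^ (m - p) * (u.*2 ^ (p - W) * u.*2 ^ W).
  by rewrite -!expnD; congr (_ ^ _); lia.
have -> : u.*2.-1 ^ p = u.*2.-1 ^ (p - W) * u.*2.-1 ^ W by rewrite -expnD subnK.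
rewrite -!mulnA [X in _ <= X]mulnCA; apply: leq_mul le _.
by rewrite mulnC -mulnA.
Qed.

End OneMoreBit.

(** Union bound over the wide clauses of [pi], with denominators cleared. An extension leaves
    [u - 1] free bits per pigeon, whence the threshold [2 ^ u.-1]. *)
Theorem refutation_size_count m k t (rho : restriction (php_var m k)) pi :
  t < k -> bit_restriction t rho -> refutation (restrict rho (BinPHP m k)) pi ->
  (k - t).*2 ^ 2 ^ (k - t).-1 <= size pi * (k - t).*2.-1 ^ 2 ^ (k - t).-1.
Proof.
move=> tk brho ref; set u := k - t; set W := 2 ^ u.-1.
have u_gt0 : 0 < u by rewrite subn_gt0.
have free i : #|[set l | rho (i, l) == None]| = u.
  rewrite -[LHS](addKn #|[set l | rho (i, l) != None]|) brho /u -[in RHS](card_ord k).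
  rewrite -(cardC (mem [set l | rho (i, l) != None])) brho; congr (_ + _ - _).
  by apply: eq_card => l; rewrite !inE negbK.
(* Fixing one more bit when [u = 1] leaves no free bit, so this case is separate. *)
have [u1|u_gt1] := leqP u 1.
  have {u1}u1 : u = 1 by apply/eqP; rewrite eqn_leq u1.
  rewrite /W u1 /= muln1 (refutation_size_ge2 _ ref) // => i.
  have : 0 < #|[set l | rho (i, l) == None]| by rewrite free.
  by case/card_gt0P => l; rewrite inE => /eqP; exists l.
have cardF : #|family (free_choices rho)| = u.*2 ^ m.
  rewrite card_family foldrE big_map big_enum /=.
  rewrite (eq_bigr (fun=> u.*2)) => [|i _]; last exact: card_free_choices.
  by rewrite prod_nat_const card_ord.
pose bad C := [set f in family (free_choices rho) | ~~ satisfied (set_bits rho f) C].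
have cover : #|family (free_choices rho)| <=
    \sum_(C <- pi | W <= #|pigeons rho C|) #|bad C|.
  apply: (@leq_trans #|\bigcup_(C <- pi | W <= #|pigeons rho C|) bad C|).
    apply/subset_leq_card/subsetP => f ff.
    have ext := set_bits_extends ff.
    have [|i|C Cpi /andP[ns wide]] := exists_wide_clause (u := u.-1) ext _ _ ref.
    - by case: (u) u_gt1 => [|[]].
    - exact: card_free_set_bits.
    (* Setting more variables only removes mentioned pigeons, so a clause wide under the extension
       is wide under [rho]. *)
    - rewrite big_mkcond bigcup_seq; apply/bigcupP; exists C => //.
      rewrite (leq_trans wide) ?subset_leq_card ?pigeons_extends //.
      by rewrite inE ff ns.
  elim/big_rec2: _ => [|C n A _ le]; first by rewrite cards0.
  by rewrite (leq_trans (leq_card_setU _ _).1) // leq_add2l.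
have um_gt0 : 0 < u.*2 ^ m by rewrite expn_gt0 double_gt0 u_gt0.
rewrite -(leq_pmul2l um_gt0) -[in X in X <= _]cardF.
apply: leq_trans (leq_mul cover (leqnn _)) _; rewrite big_distrl /=.
apply: (@leq_trans (\sum_(C <- pi | W <= #|pigeons rho C|) u.*2 ^ m * u.*2.-1 ^ W)).
  by apply: leq_sum => C wide; apply: card_unsatisfied_set_bits free wide.
by rewrite big_const_seq iter_addn_0 [X in _ <= X]mulnCA mulnC leq_mul2r count_size orbT.
Qed.

(** * From the integer count to exponential bounds over the reals *)

Local Open Scope ring_scope.

(** Raise [1 - 1/d <= exp(-1/d)] to the power [W] and cancel [d ^ W]. *)
Lemma expR_le_of_count (R : realType) (S d W : nat) : (0 < d)%N ->
  (d ^ W <= S * d.-1 ^ W)%N -> expR (W%:R / d%:R) <= S%:R :> R.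
Proof.
move=> d_gt0 count; have dR : 0 < d%:R :> R by rewrite ltr0n.
have base : (d.-1)%:R <= d%:R * expR (- d%:R^-1) :> R.
  have -> : (d.-1)%:R = d%:R * (1 + - d%:R^-1) :> R.
    have dn0 : d%:R != 0 :> R by rewrite pnatr_eq0 -lt0n.
    by rewrite mulrDr mulr1 mulrN (divff dn0) -{2}(prednK d_gt0) -natr1 addrK.
  by rewrite ler_pM2l // expR_ge1Dx.
have powers : (d ^ W)%N%:R <= S%:R * (d%:R ^+ W * expR (- (W%:R / d%:R))) :> R.
  apply: (@le_trans _ _ (S * d.-1 ^ W)%N%:R); first by rewrite ler_nat.
  rewrite natrM ler_wpM2l // natrX (le_trans (lerXn2r _ _ _ base)) ?nnegrE //.
    by rewrite mulr_ge0 ?expR_ge0.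
  by rewrite exprMn -expRM_natl mulrN.
move: powers; rewrite natrX mulrCA -[X in X <= _]mulr1 ler_pM2l ?exprn_gt0 //.
by rewrite expRN ler_pdivlMr ?expR_gt0 // mul1r.
Qed.

Lemma refutation_size_expR (R : realType) (m k t : nat) (rho : restriction (php_var m k)) pi :
  (t < k)%N -> bit_restriction t rho -> refutation (restrict rho (BinPHP m k)) pi ->
  expR ((2 ^ k)%N%:R / (2 ^ (t + 2) * (k - t))%N%:R) <= (size pi)%:R :> R.
Proof.
move=> tk brho ref; have u_gt0 : (0 < k - t)%N by rewrite subn_gt0.
have := refutation_size_count tk brho ref.
move/(@expR_le_of_count R); rewrite double_gt0 => /(_ u_gt0); apply: le_trans.
rewrite ler_expR le_eqVlt; apply/orP; left; apply/eqP.
(* With [u = k - t], numerator and denominator of [2 ^ (u - 1) / (2u)] are both scaled by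
   [2 ^ (t + 1)]. *)
have -> : (2 ^ k = 2 ^ (k - t).-1 * 2 ^ t.+1)%N.
  by rewrite -expnD; congr (2 ^ _)%N; lia.
have -> : (2 ^ (t + 2) * (k - t) = (k - t).*2 * 2 ^ t.+1)%N.
  by rewrite addn2 [(2 ^ t.+2)%N]expnS; lia.
rewrite !natrM -mulf_div divff ?mulr1 // pnatr_eq0.
by rewrite -lt0n expn_gt0.
Qed.

Theorem theorem4p4 (R : realType) :
  (forall t : nat, exists c : R, 0 < c /\ exists N : nat,
     forall (k m : nat) (rho : restriction (php_var m k))
            (pi : seq (clause (php_var m k))),
       (N <= 2 ^ k)%N -> (t < k)%N -> (2 ^ k < m)%N ->
       bit_restriction t rho ->
       refutation (restrict rho (BinPHP m k)) pi ->
       2 `^ (c * ((2 ^ k)%N%:R / k%:R)) <= (size pi)%:R)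
  /\
  (exists N : nat,
     forall (k m t : nat) (rho : restriction (php_var m k))
            (pi : seq (clause (php_var m k))),
       (N <= 2 ^ k)%N -> (t < k)%N -> (2 ^ k < m)%N ->
       bit_restriction t rho ->
       refutation (restrict rho (BinPHP m k)) pi ->
       expR ((2 ^ k)%N%:R / (2 ^ (t + 2) * (k - t))%N%:R) <= (size pi)%:R :> R).
Proof.
split=> [t|]; last first.
  by exists 0%N => k m t rho pi _ tk _; apply: refutation_size_expR.
have c_gt0 : 0 < ((2 ^ (t + 2))%N%:R : R)^-1 by rewrite invr_gt0 ltr0n expn_gt0.
(* This constant is the factor of [n / u] in the exponent of [refutation_size_expR]; it depends on
   [t] alone. *)
exists (2 ^ (t + 2))%N%:R^-1; split=> //; exists 0%N => k m rho pi _ tk _ brho ref.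
apply: le_trans (refutation_size_expR R tk brho ref).
have k_gt0 : (0 < k)%N by apply: leq_ltn_trans tk.
rewrite /powR pnatr_eq0 /= ler_expR.
set x := _ * (_ / k%:R).
have x_ge0 : 0 <= x by rewrite mulr_ge0 ?(ltW c_gt0) // divr_ge0.
(* Passing from base [2] to base [e] multiplies the exponent by [ln 2], which is at most 1. *)
apply: (@le_trans _ _ x).
  have ln2 : ln 2 <= 1 :> R by apply: le_ln1Dx; lra.
  by rewrite ler_piMr.
(* It remains to replace the denominator [k - t] by the larger [k]. *)
rewrite /x natrM invfM mulrCA ler_wpM2l //.
rewrite ler_wpM2l ?(ltW c_gt0) // lef_pV2 ?posrE ?ltr0n ?subn_gt0 //.
by rewrite ler_nat leq_subr.
Qed.
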